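(* Let $H=\langle n_1,n_2,n_3,n_4\rangle$ be a numerical semigroup minimally generated by $n_1<n_2<n_3<n_4$. For $m\ge 0$ let $H+m=\langle n_1+m,n_2+m,n_3+m,n_4+m\rangle$, considered only for those $m$ for which it is a numerical semigroup, i.e. $\gcd(n_1+m,\dots,n_4+m)=1$. Then there exists $M$ such that for all such $m\ge M$, $H+m$ is not almost symmetric of type $2$.
   Context: A numerical semigroup is a submonoid $H\subset\mathbb N$ with $0\in H$ and $\mathbb N\setminus H$ finite; $\langle n_1,\dots,n_e\rangle$ is the submonoid generated by the $n_i$. $\mathrm F(H)=\max(\mathbb N\setminus H)$; $\mathrm{PF}(H)=\{f\in\mathbb Z\setminus H : f+h\in H\text{ for all }0\ne h\in H\}$; the type of $H$ is $|\mathrm{PF}(H)|$; $H$ is almost symmetric if $2|\mathbb N\setminus H|=\mathrm F(H)+|\mathrm{PF}(H)|$. *)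

(* Defs.v *)
From HB Require Import structures.
From mathcomp Require Import all_boot all_order all_algebra finmap.
From mathcomp Require Import boolp classical_sets functions cardinality.
Set Implicit Arguments.
Unset Strict Implicit.
Unset Printing Implicit Defensive.
Local Open Scope classical_set_scope.
Local Open Scope nat_scope.

Definition submonoid (H : set nat) : Prop :=
  H 0 /\ forall x y, H x -> H y -> H (x + y).

Definition numerical_semigroup (H : set nat) : Prop :=
  submonoid H /\ finite_set (~` H).

Definition generated (A : set nat) : set nat := smallest submonoid A.

Definition minimally_generates (A H : set nat) : Prop :=
  generated A = H /\ forall B, B `<` A -> generated B <> H.

(* [fset_set] is meaningful only for finite sets; for numerical semigroups the
   gaps are finite by definition, and the pseudo-Frobenius numbers by
   [finite_pseudo_frobenius] below. *)
Definition gaps (H : set nat) : {fset nat} := fset_set (~` H).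

(* The maximum of an empty set is 0 here, so the value is meaningless for
   H = setT; this is the only numerical semigroup without gaps. *)
Definition frobenius (H : set nat) : nat := \max_(x <- gaps H) x.

Definition pseudo_frobenius (H : set nat) : set int :=
  [set f : int | ~ (Posz @` H) f /\
    forall h : nat, H h -> h <> 0 -> (Posz @` H) (f + h%:Z)%R].

Definition semigroup_type (H : set nat) : nat :=
  #|` fset_set (pseudo_frobenius H)|%fset.

Definition almost_symmetric (H : set nat) : Prop :=
  2 * #|` gaps H|%fset = frobenius H + semigroup_type H.

Lemma gap_le_frobenius H x : numerical_semigroup H -> ~ H x ->
  x <= frobenius H.
Proof.
move=> [_ finH] Hx; rewrite /frobenius.
by apply: (@leq_bigmax_seq _ _ xpredT id) => //; rewrite in_fset_set// inE.
Qed.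

Lemma finite_pseudo_frobenius H : numerical_semigroup H ->
  finite_set (pseudo_frobenius H).
Proof.
move=> nH; have [_ finH] := nH; set h := (frobenius H).+1.
have Hh : H h.
  by apply: contrapT => /(gap_le_frobenius nH); rewrite ltnn.
apply: (@sub_finite_set _ _
    ((Posz @` (~` H)) `|` ((fun k : nat => (k%:Z - h%:Z)%R) @` `I_h))).
  move=> f [fNH /(_ h Hh)]; case=> // k Hk kE.
  have fE : f = (k%:Z - h%:Z)%R by rewrite kE GRing.addrK.
  have [hk|kh] := leqP h k; last by right; exists k.
  left; exists (k - h); last by rewrite fE subzn.
  by move=> Hkh; apply: fNH; exists (k - h) => //; rewrite fE subzn.
by rewrite finite_setU; split; apply: finite_image => //; exact: finite_II.
Qed.

Lemma submonoid_muln H k x : submonoid H -> H x -> H (k * x).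
Proof.
move=> [H0 HD] Hx; elim: k => [|k IH]; first by rewrite mul0n.
by rewrite mulSn; exact: HD.
Qed.

Lemma submonoid_generated A : submonoid (generated A).
Proof.
split=> [B [[]]//|x y Ax Ay B BA].
by apply: (proj2 (proj1 BA)); [exact: Ax | exact: Ay].
Qed.

Lemma sub_generated A : A `<=` generated A.
Proof. by move=> x Ax B [_]; apply. Qed.

Lemma numerical_semigroup_gcdP a b c d : 0 < a ->
  numerical_semigroup (generated [set a; b; c; d]) <->
  gcdn (gcdn (gcdn a b) c) d = 1.
Proof.
move=> a0; set S := [set a; b; c; d]; set H := generated S.
set g := gcdn _ d; have HM : submonoid H := submonoid_generated S.
have [H0 HD] := HM; split=> [nH|g1].
  have dH x : H x -> g %| x.
    move=> /(_ [set y | g %| y]); apply; split.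
      by split=> [|y z gy gz] /=; [exact: dvdn0 | exact: dvdn_add].
    have gabc : g %| gcdn (gcdn a b) c := dvdn_gcdl _ _.
    have gab := dvdn_trans gabc (dvdn_gcdl _ _).
    move=> y [[[|]|]|] /= ->; last exact: dvdn_gcdr.
    - exact: dvdn_trans gab (dvdn_gcdl _ _).
    - exact: dvdn_trans gab (dvdn_gcdr _ _).
    - exact: dvdn_trans gabc (dvdn_gcdr _ _).
  have big x : frobenius H < x -> H x.
    rewrite ltnNge => /negP Fx; apply: contrapT => Hx.
    exact/Fx/gap_le_frobenius.
  have /dH g1 := big _ (leqnn (frobenius H).+1).
  have /dH := big _ (leqnSn (frobenius H).+1).
  by rewrite -addn1 dvdn_addr// dvdn1 => /eqP.
split=> //; have Sa : H a by apply: sub_generated; left; left; left.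
pose G := [set y | exists k, H (y + k * a)].
have HG y : H y -> G y by exists 0; rewrite addn0.
have Ggcd y z : G y -> G z -> G (gcdn y z).
  move=> Gy Gz; have [->|y0] := posnP y; first by rewrite gcd0n.
  have [u _ /dvdnP[v uv]] := Bezoutl z y0.
  have [[i Hi] [j Hj]] := (Gy, Gz).
  exists (u * z + v * i + a.-1 * u * j).
  rewrite (_ : _ + _ = v * (y + i * a) + (a.-1 * u) * (z + j * a)).
    exact: HD (submonoid_muln _ HM Hi) (submonoid_muln _ HM Hj).
  have uza : u * z * a = u * z + a.-1 * u * z.
    by rewrite -{1}(prednK a0) mulnS [u * z * _]mulnC mulnA.
  by rewrite !mulnDl !mulnDr uza -uv !mulnA -!addnA [v * i * a + (_ + _)]addnCA.
have [k Hk] : G 1.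
  have GS y : S y -> G y by move=> Sy; apply: HG; exact: sub_generated.
  rewrite -g1; apply: (Ggcd); last by apply: GS; right.
  apply: (Ggcd); last by apply: GS; left; right.
  by apply: (Ggcd); apply: GS; left; left; [left|right].
set x := 1 + k * a in Hk.
apply: (@sub_finite_set _ _ `I_(a * x)); last exact: finite_II.
move=> n /= Hn; rewrite ltnNge; apply/negP => axn; apply: Hn.
have rx : n %% a * x <= n.
  by apply: leq_trans axn; rewrite leq_mul2r ltnW ?orbT// ltn_mod.
rewrite -(subnK rx); apply: (HD); last exact: (submonoid_muln _ HM Hk).
suff /dvdnP[q ->] : a %| n - n %% a * x by exact: (submonoid_muln _ HM Sa).
rewrite -eqn_mod_dvd// /x mulnDr muln1 mulnA.
by rewrite eq_sym -modnDmr modnMl addn0 modn_mod.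
Qed.

(* Main.v *)
(* Write the generators of H + m as a, a + s, a + t, a + D with a = n1 + m and
   let d = gcd(s, t, D), which is prime to a. Then H + m is the union of the
   levels k a + k S, where k S is the k-fold sumset of S = {0, s, t, D}. For
   large k the set k S looks like A = <s, t, D> near 0 and like k D - B near k D,
   with B = <D - s, D - t, D>, and contains every multiple of d in between; for
   large a distinct levels of the same class mod d do not interfere unless k D
   is about d a.

   Almost symmetric of type 2 means that F = 2h and that x |-> F - x exchanges
   elements and non-elements except at x = h. Reflecting the start of level
   k + d and the top of level k, for a fixed k, gives the start and the top of
   one and the same level j:
     F = (k + d + j) a + phi = (k + j) (a + D) - psi,
   with phi and psi bounded multiples of d. If phi / d were even, then
   (k + d) a + phi / 2 would be reflected to j a + phi / 2, although each of them
   lies in H + m exactly when phi / 2 lies in A; hence phi / d is odd, and so is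
   psi / d by the same argument with B. Now F even, d a = (k + j) D - phi - psi
   and gcd(a, d) = 1 contradict each other modulo 2. *)

Require Import Defs.
From mathcomp Require Import all_boot all_order all_algebra finmap.
From mathcomp Require Import boolp classical_sets functions cardinality.
From mathcomp Require Import zify ring.
Local Open Scope classical_set_scope.
Local Open Scope nat_scope.

Section IntegerCore.
Import Order.TTheory GRing.Theory Num.Theory.
Local Open Scope ring_scope.

(** * Sumsets of [{0, s, t, D}] and their stable range *)

Definition comb (s t D z : int) : Prop :=
  exists p q r : int, [/\ 0 <= p, 0 <= q, 0 <= r & z = p * s + q * t + r * D].

(* The [k]-fold sumset of [{0, s, t, D}], the remaining [k - p - q - r] summands
   being [0]. *)
Definition level (s t D k z : int) : Prop :=
  exists p q r : int, [/\ 0 <= p, 0 <= q, 0 <= r, p + q + r <= k &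
                          z = p * s + q * t + r * D].

Definition shifted (a s t D n : int) : Prop :=
  exists2 k : int, 0 <= k & level s t D k (n - k * a).

Lemma divz_bounds (D p : int) : 0 < D ->
  exists u v, [/\ p = u * D + v, 0 <= v & v < D].
Proof.
move=> D0; exists (p %/ D)%Z, (p %% D)%Z.
by rewrite -divz_eq modz_ge0 ?ltz_pmod//; lia.
Qed.

(* Trading [D] copies of [s] for [s] copies of [D] lowers the number of
   summands, so fewer than [D] copies of [s] and of [t] suffice. *)
Lemma comb_level (s t D k z : int) : 0 < D -> 0 <= s <= D -> 0 <= t <= D ->
  comb s t D z -> z <= k * D - 2 * D ^+ 2 -> level s t D k z.
Proof.
move=> D0 sD tD [p [q [r [p0 q0 r0 zE]]]] zk.
have [p1 [p2 [pE p20 p2D]]] := divz_bounds D p D0.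
have [q1 [q2 [qE q20 q2D]]] := divz_bounds D q D0.
have p10 : 0 <= p1 by nia.
have q10 : 0 <= q1 by nia.
exists p2, q2, (r + p1 * s + q1 * t).
have e : z = p2 * s + q2 * t + (r + p1 * s + q1 * t) * D.
  by rewrite zE pE qE; ring.
have r'0 : 0 <= r + p1 * s + q1 * t by nia.
split=> //.
(* At most [k - 2 * D] copies of [D] stand beside fewer than [2 * D] copies of [s] and [t]. *)
have : (r + p1 * s + q1 * t) * D <= (k - 2 * D) * D by nia.
rewrite ler_pM2r//; lia.
Qed.

(** Bezout gives integer coefficients. Reducing those of [s] and [t] modulo [D] leaves them a
    contribution below [2 * D ^+ 2], so the coefficient of [D] cannot be negative. *)
Lemma comb_large (s t D z : int) : 0 < D -> 0 <= s <= D -> 0 <= t <= D ->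
  (gcdz (gcdz s t) D %| z)%Z -> 2 * D ^+ 2 <= z -> comb s t D z.
Proof.
move=> D0 sD tD /dvdzP[m ->].
have [u [v e1]] := Bezoutz s t.
have [u' [v' e2]] := Bezoutz (gcdz s t) D.
rewrite -e2 -e1 => zE.
have [p1 [p2 [pE p20 p2D]]] := divz_bounds D (m * u' * u) D0.
have [q1 [q2 [qE q20 q2D]]] := divz_bounds D (m * u' * v) D0.
have e : m * (u' * (u * s + v * t) + v' * D) =
    p2 * s + q2 * t + (m * v' + p1 * s + q1 * t) * D.
  transitivity (m * u' * u * s + m * u' * v * t + m * v' * D); first by ring.
  by rewrite pE qE; ring.
exists p2, q2, (m * v' + p1 * s + q1 * t); split=> //.
have : 0 <= (m * v' + p1 * s + q1 * t) * D by rewrite e in zE; nia.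
by rewrite pmulr_lge0.
Qed.

Lemma level_bounds (s t D k z : int) : 0 < D -> 0 <= s <= D -> 0 <= t <= D ->
  level s t D k z -> 0 <= z <= k * D.
Proof.
move=> D0 sD tD [p [q [r [p0 q0 r0 pk ->]]]].
have ? : 0 <= p * s <= p * D by nia.
have ? : 0 <= q * t <= q * D by nia.
have ? : (p + q + r) * D <= k * D by rewrite ler_pM2r.
nia.
Qed.

Lemma level_comb (s t D k z : int) : level s t D k z -> comb s t D z.
Proof. by move=> [p [q [r [p0 q0 r0 _ e]]]]; exists p, q, r. Qed.

Lemma comb_dvd (d s t D z : int) : (d %| s)%Z -> (d %| t)%Z -> (d %| D)%Z ->
  comb s t D z -> (d %| z)%Z.
Proof.
by move=> ds dt dD [p [q [r [_ _ _ ->]]]]; rewrite !rpredD// dvdz_mull.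
Qed.

(** Replace each of the [k] summands [x] by [D - x]; copies of [0] and of [D] change places. *)
Lemma level_mirror (s t D k z : int) :
  level s t D k z -> level (D - s) (D - t) D k (k * D - z).
Proof.
move=> [p [q [r [p0 q0 r0 pk ->]]]]; exists p, q, (k - p - q - r).
by split; try lia; ring.
Qed.

Lemma shifted_mirror (a s t D n : int) :
  shifted a s t D n <->
  exists2 k, 0 <= k & level (D - s) (D - t) D k (k * (a + D) - n).
Proof.
have subK x : D - (D - x) = x by ring.
have top k : k * (a + D) - n = k * D - (n - k * a) by ring.
split=> -[k k0 /level_mirror h]; exists k => //; first by rewrite top.
by move: h; rewrite top !subK (_ : k * D - _ = n - k * a)//; ring.
Qed.

(** * Separation of levels in one class modulo [d] *)

Lemma coprime_levels (a d i j y z : int) : 0 < d -> coprimez a d ->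
  (d %| y)%Z -> (d %| z)%Z -> i * a + y = j * a + z ->
  [\/ i = j, i <= j - d | j + d <= i].
Proof.
move=> d0 co dy dz e.
have : (d %| (i - j) * a)%Z.
  by rewrite (_ : _ * _ = z - y) ?rpredB//; lia.
rewrite Gauss_dvdzl; last by rewrite coprimez_sym.
move=> /dvdzP[m ij].
have [m0|[m1|m1]] : m = 0 \/ (m <= -1 \/ 1 <= m) by lia.
- by constructor 1; move: ij; rewrite m0 mul0r; lia.
- by constructor 2; nia.
- by constructor 3; nia.
Qed.

(** Any other level that could contain the point has index at least [k + d], and starts too late, or
    at most [k - d], and ends too early. *)
Lemma shifted_start (a s t D d k y Y : int) :
  0 < D -> 0 <= s <= D -> 0 <= t <= D -> 0 < d -> 0 < a ->
  (d %| s)%Z -> (d %| t)%Z -> (d %| D)%Z -> coprimez a d ->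
  (d %| y)%Z -> - Y <= y <= Y -> 0 <= k -> k * D + Y < d * a ->
  shifted a s t D (k * a + y) -> comb s t D y.
Proof.
move=> D0 sD tD d0 a0 ds dt dD co dy yY k0 kY [j j0 l].
have := level_bounds _ _ _ _ _ D0 sD tD l.
have dz := comb_dvd _ _ _ _ _ ds dt dD (level_comb _ _ _ _ _ l).
have e : k * a + y = j * a + (k * a + y - j * a) by ring.
have [kj|kj|kj] := coprime_levels _ _ _ _ _ _ d0 co dy dz e.
- by move: (level_comb _ _ _ _ _ l); rewrite kj [j * a + y]addrC addrK.
- by nia.
- have ? : j * (a + D) <= (k - d) * (a + D) by rewrite ler_pM2r; lia.
  have ? : 0 <= d * D by nia.
  by lia.
Qed.

Lemma shifted_top (a s t D d k y Y : int) :
  0 < D -> 0 <= s <= D -> 0 <= t <= D -> 0 < d -> 0 < a ->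
  (d %| s)%Z -> (d %| t)%Z -> (d %| D)%Z -> coprimez a d ->
  (d %| y)%Z -> - Y <= y <= Y -> 0 <= k -> k * D + Y < d * a ->
  shifted a s t D (k * (a + D) - y) -> comb (D - s) (D - t) D y.
Proof.
move=> D0 sD tD d0 a0 ds dt dD co dy yY k0 kY /shifted_mirror[j j0 l].
have sD' : 0 <= D - s <= D by lia.
have tD' : 0 <= D - t <= D by lia.
have := level_bounds _ _ _ _ _ D0 sD' tD' l.
have ds' : (d %| D - s)%Z by rewrite rpredB.
have dt' : (d %| D - t)%Z by rewrite rpredB.
have dz := comb_dvd _ _ _ _ _ ds' dt' dD (level_comb _ _ _ _ _ l).
set z := j * (a + D) - _ in l dz * => zj.
have zE : z = j * a + j * D - k * a - k * D + y by rewrite /z; ring.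
have dkD : (d %| k * D - y)%Z by rewrite rpredB// dvdz_mull.
have djD : (d %| j * D - z)%Z by rewrite rpredB// dvdz_mull.
have e : k * a + (k * D - y) = j * a + (j * D - z) by rewrite zE; ring.
have := coprime_levels _ _ _ _ _ _ d0 co dkD djD e.
move: (level_comb _ _ _ _ _ l) => cz.
clearbody z; clear -D0 d0 a0 yY k0 kY zj zE cz => -[kj|kj|kj].
- suff -> : y = z by [].
  by rewrite zE kj; ring.
- have ? : (k + d) * a <= j * a by rewrite ler_pM2r; lia.
  by lia.
- have ? : j * (a + D) <= (k - d) * (a + D) by rewrite ler_pM2r; lia.
  have ? : 0 <= d * D by nia.
  by lia.
Qed.

(* The reflection [x |-> F - x] carries the end of level [k] to the end, on the
   same side, of a level [j]; [sg] is [1] at the starts of levels and [-1] at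
   their tops. *)
Lemma reflect_end (H : int -> Prop) (lev : int -> int -> Prop)
    (cmb : int -> Prop) (b sg D d E F k : int) :
  0 < d -> sg = 1 \/ sg = -1 ->
  (forall n, H n <-> exists2 j, 0 <= j & lev j (sg * (n - j * b))) ->
  (forall j z, lev j z -> (d %| z)%Z /\ 0 <= z <= j * D) ->
  (forall j z, cmb z -> z <= j * D - E -> lev j z) ->
  (forall z, (d %| z)%Z -> E <= z -> cmb z) ->
  (forall x, 2 * x < F -> H x <-> ~ H (F - x)) ->
  (d %| E)%Z -> 0 <= k -> 2 * E <= k * D ->
  2 * (k * b - sg * d) < F -> 2 * (k * b + sg * E) < F ->
  ~ H (k * b - sg * d) ->
  ~ H (F - (k * b + sg * E)) /\
  exists j phi, [/\ 0 <= j, F = (k + j) * b + sg * phi, (d %| phi)%Z &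
                    - d <= phi < 2 * E].
Proof.
move=> d0 sg1 HE levP cmbL cmbE sym dE k0 kE lt1 lt2 nH.
have sgK x : sg * (sg * x) = x by case: sg1 => ->; lia.
(* At distance [E] inside level [k] there is an element, so its mirror image is missing. *)
have nH2 : ~ H (F - (k * b + sg * E)).
  apply/(sym _ lt2)/HE; exists k => //.
  rewrite (_ : sg * _ = E); last by rewrite [k * b + _]addrC addrK sgK.
  by apply: cmbL; [exact: cmbE|lia].
split=> //.
have : H (F - (k * b - sg * d)).
  by apply: contrapT => h; apply: nH; apply/(sym _ lt1).
move=> /HE[j j0]; set z := sg * _ => l.
have [dz zj] := levP _ _ l.
have FE : F = (k + j) * b + sg * (z - d).
  by rewrite mulrBr {1}/z sgK; ring.
exists j, (z - d); split=> //; first by rewrite rpredB.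
(* If [phi] were at least [2 * E], that missing image would lie in the full middle range of level
   [j]. *)
apply/andP; split; first lia.
rewrite ltNge; apply/negP => zE; apply: nH2; apply/HE; exists j => //.
rewrite (_ : sg * _ = z - d - E).
  apply: cmbL; last by lia.
  by apply: cmbE; [rewrite !rpredB|lia].
by rewrite FE -[RHS]sgK; congr (sg * _); ring.
Qed.

(** * The parity contradiction for a reflection on the integers *)

Ltac lia_nodvd :=
  repeat match goal with
  | h : context [dvdz] |- _ => clear h
  | h : context [gcdz] |- _ => clear h
  | h : context [coprimez] |- _ => clear h
  end; lia.

Lemma shifted_not_pseudo_symmetric (a s t D d h : int) :
  0 < D -> 0 <= s <= D -> 0 <= t <= D -> 100 * D ^+ 2 <= a ->
  d = gcdz (gcdz s t) D -> coprimez a d -> 0 <= h ->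
  ~ (forall x, x != h ->
       (shifted a s t D x <-> ~ shifted a s t D (2 * h - x))).
Proof.
set H := shifted a s t D; set F := 2 * h.
move=> D0 sD tD aD dE co h0 sym'.
have sym x : 2 * x < F -> H x <-> ~ H (F - x).
  by move=> xF; apply: sym'; apply/eqP => xh; move: xF; rewrite /F xh; lia_nodvd.
have dvD : (d %| D)%Z by rewrite dE dvdz_gcdr.
have dvs : (d %| s)%Z by rewrite dE (dvdz_trans (dvdz_gcdl _ _))// dvdz_gcdl.
have dvt : (d %| t)%Z by rewrite dE (dvdz_trans (dvdz_gcdl _ _))// dvdz_gcdr.
have d0 : 0 < d by rewrite lt0r dE gcdz_eq0 negb_and (gt_eqF D0) orbT.
have dD : d <= D.
  case/dvdzP: dvD => q Dq; clear -D0 d0 Dq.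
  have q0 : 0 < q by nia.
  by nia.
have sD' : 0 <= D - s <= D by lia_nodvd.
have tD' : 0 <= D - t <= D by lia_nodvd.
have dvs' : (d %| D - s)%Z by rewrite rpredB.
have dvt' : (d %| D - t)%Z by rewrite rpredB.
pose E := 2 * D ^+ 2.
have dvE : (d %| E)%Z by rewrite dvdz_mull// dvdz_mulr.
have DE : 2 * D <= E by clear -D0; rewrite /E expr2; nia.
have dDE : d * D <= E by clear -D0 d0 dD; rewrite /E expr2; nia.
have cmbL s' t' : 0 <= s' <= D -> 0 <= t' <= D ->
    forall j z, comb s' t' D z -> z <= j * D - E -> level s' t' D j z.
  by move=> s'D t'D j z cz zj; apply: comb_level.
have cmbE s' t' : 0 <= s' <= D -> 0 <= t' <= D ->
    (gcdz (gcdz s' t') D %| d)%Z ->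
    forall z, (d %| z)%Z -> E <= z -> comb s' t' D z.
  by move=> s'D t'D gd z dz; apply: comb_large => //; exact: dvdz_trans dz.
have aE : 50 * E <= a by rewrite /E; lia_nodvd.
have a0 : 0 < a by lia_nodvd.
have daE : 50 * E <= d * a by clear -a0 d0 aE; nia.
(* This gives [k * D = 8 * E]: level [k] has a full middle range, and the level [j] found below
   satisfies [j * D + 2 * E < d * a]. *)
pose k := 16 * D.
have kD : k * D = 8 * E by rewrite /k /E; ring.
have k0 : 0 <= k by rewrite /k; lia_nodvd.
clearbody k E; clear aD.
have HT n : H n <-> exists2 j, 0 <= j & level s t D j (1 * (n - j * a)).
  by split=> -[j j0 l]; exists j => //; move: l; rewrite mul1r.
have HB n : H n <-> exists2 j, 0 <= j &
    level (D - s) (D - t) D j (-1 * (n - j * (a + D))).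
  have e j : -1 * (n - j * (a + D)) = j * (a + D) - n by ring.
  split=> [/shifted_mirror|hn]; last apply/shifted_mirror.
    by move=> [j j0 l]; exists j; rewrite ?e.
  by case: hn => j j0; rewrite e; exists j.
have start j y : 0 <= j -> (d %| y)%Z -> - (2 * E) <= y <= 2 * E ->
    j * D + 2 * E < d * a -> H (j * a + y) -> comb s t D y.
  by move=> j0 dy yE jE; apply: shifted_start jE.
have top j y : 0 <= j -> (d %| y)%Z -> - (2 * E) <= y <= 2 * E ->
    j * D + 2 * E < d * a -> H (j * (a + D) - y) -> comb (D - s) (D - t) D y.
  by move=> j0 dy yE jE; apply: shifted_top jE.
have ncomb s' t' : 0 <= s' <= D -> 0 <= t' <= D -> ~ comb s' t' D (- d).
  move=> s'D t'D [p [q [r [p0 q0 r0]]]].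
  have ? : 0 <= p * s' by rewrite mulr_ge0//; case/andP: s'D.
  have ? : 0 <= q * t' by rewrite mulr_ge0//; case/andP: t'D.
  have ? : 0 <= r * D by rewrite mulr_ge0// ltW.
  by lia_nodvd.
(* This [x] lies just before the start of a level, hence outside [H]; were it beyond [F], its image
   would be negative and [x] an element. The factor puts the ends of levels [k] and [k + d] below
   [F / 2]. *)
have Fbig : (2 * (k + d) + 3) * a - d <= F.
  rewrite leNgt; apply/negP => Fx.
  set x := (2 * (k + d) + 3) * a - d in Fx.
  have Hx : H x.
    apply/sym'; first by apply/eqP => xh; move: Fx; rewrite xh /F; lia_nodvd.
    move=> [j j0 l]; have := level_bounds _ _ _ _ _ D0 sD tD l.
    have : 0 <= j * a by rewrite mulr_ge0// ltW.
    lia_nodvd.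
  apply: (ncomb _ _ sD tD); apply: (start (2 * (k + d) + 3)) => //.
  - lia_nodvd.
  - by rewrite rpredN.
  - lia_nodvd.
  - lia_nodvd.
have kdD : (k + d) * D = 8 * E + d * D by rewrite mulrDl kD.
have dD0 : 0 <= d * D by rewrite mulr_ge0// ltW.
have da0 : 0 <= d * a by rewrite mulr_ge0// ltW.
have levP s' t' : 0 <= s' <= D -> 0 <= t' <= D -> (d %| s')%Z -> (d %| t')%Z ->
    forall j z, level s' t' D j z -> (d %| z)%Z /\ 0 <= z <= j * D.
  move=> s'D t'D ds' dt' j z l; split; last exact: level_bounds l.
  exact: comb_dvd (level_comb _ _ _ _ _ l).
have [nP [j [phi [j0 FE dphi phiE]]]] : ~ H (F - ((k + d) * a + 1 * E)) /\
    exists j phi, [/\ 0 <= j, F = (k + d + j) * a + 1 * phi, (d %| phi)%Z &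
                      - d <= phi < 2 * E].
  apply: (reflect_end H (level s t D) (comb s t D) _ _ D) => //.
  - by left.
  - exact: levP.
  - exact: cmbL.
  - by apply: cmbE => //; rewrite dE.
  - lia_nodvd.
  - lia_nodvd.
  - lia_nodvd.
  - lia_nodvd.
  - rewrite mul1r => hx; apply: (ncomb _ _ sD tD).
    apply: (start (k + d)) => //; [lia_nodvd|by rewrite rpredN|lia_nodvd|lia_nodvd].
have gcd' : (gcdz (gcdz (D - s) (D - t)) D %| d)%Z.
  rewrite dE.
  set g := gcdz (gcdz (D - s) _) D.
  have gD : (g %| D)%Z by rewrite dvdz_gcdr.
  have gs : (g %| D - s)%Z by rewrite (dvdz_trans (dvdz_gcdl _ _))// dvdz_gcdl.
  have gt : (g %| D - t)%Z by rewrite (dvdz_trans (dvdz_gcdl _ _))// dvdz_gcdr.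
  have gs' : (g %| s)%Z by rewrite -(subKr D s) rpredB.
  have gt' : (g %| t)%Z by rewrite -(subKr D t) rpredB.
  by rewrite !dvdz_gcd gs' gt' gD.
have [_ [j' [psi [j'0 FE' dpsi psiE]]]] : ~ H (F - (k * (a + D) + -1 * E)) /\
    exists j phi, [/\ 0 <= j, F = (k + j) * (a + D) + -1 * phi, (d %| phi)%Z &
                      - d <= phi < 2 * E].
  apply: (reflect_end H (level (D - s) (D - t) D) (comb (D - s) (D - t) D)
    _ _ D) => //.
  - by right.
  - exact: levP.
  - exact: cmbL.
  - exact: cmbE.
  - lia_nodvd.
  - lia_nodvd.
  - lia_nodvd.
  - rewrite (_ : _ - _ = k * (a + D) - (- d)); last by ring.
    move=> hx; apply: (ncomb _ _ sD' tD').
    apply: (top k) => //; [by rewrite rpredN|lia_nodvd|lia_nodvd].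
have startH i y : 0 <= i -> y <= i * D - E -> comb s t D y -> H (i * a + y).
  move=> i0 yi cy; apply/HT; exists i => //.
  by rewrite mul1r addrC addKr; exact: cmbL.
have topH i y : 0 <= i -> y <= i * D - E -> comb (D - s) (D - t) D y ->
    H (i * (a + D) - y).
  move=> i0 yi cy; apply/HB; exists i => //.
  by rewrite (_ : -1 * _ = y); [exact: cmbL|ring].
(* Otherwise level [j'] would reach down to the point excluded by [nP]. *)
have j'D : j' * D < psi + d * a - k * D + 2 * E.
  rewrite ltNge; apply/negP => le; apply: nP.
  rewrite (_ : _ - _ = j' * (a + D) - (psi + d * a - k * D + E)); last first.
    by rewrite FE'; ring.
  apply: topH => //; first by lia_nodvd.
  apply: cmbE => //; last by lia_nodvd.
  by rewrite rpredD// rpredB ?dvdz_mull// rpredD// dvdz_mulr.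
have j'D0 : 0 <= j' * D by rewrite mulr_ge0// ltW.
have gap : (j - j' + d) * a = (j' + k) * D - psi - phi.
  have e : (k + d + j) * a + 1 * phi = (k + j') * (a + D) + -1 * psi.
    by rewrite -FE -FE'.
  by lia_nodvd.
(* The right side of [gap] lies strictly between [0] and [2 * d * a], so [j - j'] lies strictly
   between [- d] and [d]; it is also a multiple of [d]. *)
have jj : j = j'.
  have dy : (d %| d * a + phi)%Z by rewrite rpredD// dvdz_mulr.
  have dz : (d %| (j' + k) * D - psi)%Z by rewrite rpredB// dvdz_mull.
  have e : j * a + (d * a + phi) = j' * a + ((j' + k) * D - psi) by lia_nodvd.
  have [//|lt|gt] := coprime_levels _ _ _ _ _ _ d0 co dy dz e.
  - have ? : (j - j' + d) * a <= 0 by rewrite mulr_le0_ge0; lia_nodvd.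
    by lia_nodvd.
  - have ? : (d + d) * a <= (j - j' + d) * a by rewrite ler_pM2r; lia_nodvd.
    by lia_nodvd.
subst j'.
have kE : 2 * E <= k * D - E by lia_nodvd.
have jE : 2 * E <= j * D - E by lia_nodvd.
have jDa : j * D + 2 * E < d * a by lia_nodvd.
have /dvdzP[D1 DD] := dvD.
have /dvdzP[f phif] := dphi.
have /dvdzP[g psig] := dpsi.
have oddf u : f <> 2 * u.
  move=> fu; have dy : (d %| u * d)%Z by rewrite dvdz_mull.
  have phiu : phi = 2 * (u * d) by rewrite phif fu; ring.
  have := sym ((k + d) * a + u * d).
  rewrite (_ : F - _ = j * a + u * d); last by rewrite FE phiu; ring.
  have h1 : H ((k + d) * a + u * d) <-> comb s t D (u * d).
    split; [apply: start|apply: startH] => //; lia_nodvd.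
  have h2 : H (j * a + u * d) <-> comb s t D (u * d).
    split; [apply: start|apply: startH] => //; lia_nodvd.
  rewrite h1 h2 => /(_ ltac:(lia_nodvd)); tauto.
have oddg u : g <> 2 * u.
  move=> gu; have dy : (d %| u * d)%Z by rewrite dvdz_mull.
  have psiu : psi = 2 * (u * d) by rewrite psig gu; ring.
  have := sym (k * (a + D) - u * d).
  rewrite (_ : F - _ = j * (a + D) - u * d); last by rewrite FE' psiu; ring.
  have h1 : H (k * (a + D) - u * d) <-> comb (D - s) (D - t) D (u * d).
    split; [apply: top|apply: topH] => //; lia_nodvd.
  have h2 : H (j * (a + D) - u * d) <-> comb (D - s) (D - t) D (u * d).
    split; [apply: top|apply: topH] => //; lia_nodvd.
  rewrite h1 h2 => /(_ ltac:(lia_nodvd)); tauto.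
have aE' : a = (j + k) * D1 - g - f.
  have dn0 : d != 0 by rewrite gt_eqF.
  apply: (mulIf dn0); transitivity ((j - j + d) * a); first by ring.
  by rewrite gap psig phif {1}DD; ring.
have ad u v : a = 2 * u -> d = 2 * v -> False.
  move=> au dv; have : (2 %| gcdz a d)%Z.
    by rewrite dvdz_gcd au dv !dvdz_mulr.
  by rewrite (eqP co).
have parity (x : int) : exists u, x = 2 * u \/ x = 2 * u + 1.
  have [u [v [-> v0 v2]]] := divz_bounds 2 x isT.
  by exists u; clear -v0 v2; lia.
have [f' [|ff]] := parity f; first by move/oddf.
have [g' [|gg]] := parity g; first by move/oddg.
have [u au] := parity a.
have [w jk] := parity (j + k).
have [e de] := parity d.
have F2 : 2 * h = ((j + k) + d) * a + f * d by rewrite -/F FE -phif; ring.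
clear -F2 aE' ad au jk de ff gg.
(* For [a] even, [d] is odd and so is [f * d]. For [a] odd, [aE'] makes [j + k] odd. Either way [F2]
   has an odd right side. *)
case: au => au.
  case: de => de; first exact: ad au de.
  have : 2 * h = 2 * ((j + k + d) * u + f' * d + e) + 1.
    by rewrite F2 au ff de; ring.
  by lia.
case: jk => jk.
  by move: aE'; rewrite au jk ff gg -mulrA; lia.
have : 2 * h = 2 * (2 * w * u + w + u + d * u + f' * d + d) + 1.
  by rewrite F2 jk au ff; ring.
by lia.
Qed.

End IntegerCore.

(** * From almost symmetry of type 2 to the integer statement *)

(** The gaps and their mirror images cover [[0, F]], since [F] is a gap. As there are [(F + 2) / 2]
    gaps, the two sets share exactly one point; the mirror image of that point is also shared, so it
    is [F / 2]. *)
Lemma almost_symmetric_type2_reflection (H : set nat) :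
  numerical_semigroup H -> almost_symmetric H -> semigroup_type H = 2 ->
  exists h, (forall x, 2 * h < x -> H x) /\
    forall x, x <= 2 * h -> x <> h -> (H x <-> ~ H (2 * h - x)).
Proof.
move=> nH + t2; rewrite /almost_symmetric t2.
set F := frobenius H => gF.
have [[H0 HD] finH] := nH.
have gapE x : (x \in gaps H) = ~~ `[< H x >].
  by rewrite in_fset_set//; apply/idP/asboolPn; rewrite inE.
have gapF x : x \in gaps H -> x <= F.
  by rewrite gapE => /asboolPn; exact: gap_le_frobenius.
have gap0 : 0 \notin gaps H by rewrite gapE negbK; apply/asboolP.
(* The default maximum [0] is ruled out: without gaps [gF] would read [0 = F + 2], and [0] itself is
   not a gap. *)
have F_gap : F \in gaps H.
  have [F0|//] : F = 0 \/ F \in gaps H.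
    rewrite {1 2}/F /frobenius big_seq.
    apply: (big_ind (fun x => x = 0 \/ x \in gaps H)) => [|x y ? ?|]; try by auto.
    by rewrite /maxn; case: ifP.
  have [g0|[x xg]] := fset_0Vmem (gaps H).
    by move: gF; rewrite g0 cardfs0; lia.
  by move: (gapF _ xg) (xg); rewrite F0 leqn0 => /eqP->; rewrite (negPf gap0).
have HFN x : x <= F -> H x -> ~ H (F - x).
  move=> xF Hx HFx; move: F_gap; rewrite gapE => /asboolPn; apply.
  by rewrite -(subnKC xF); exact: HD.
pose G := [set i : 'I_F.+1 | (i : nat) \in gaps H]%SET.
have cardG : #|G| = #|` gaps H|%fset.
  rewrite cardE -(size_map val); apply: perm_size; apply: uniq_perm.
  - by rewrite map_inj_uniq ?enum_uniq//; exact: val_inj.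
  - exact: fset_uniq.
  move=> x; apply/mapP/idP => [[i]|xg].
    by rewrite mem_enum inE => ig ->.
  have xF : x < F.+1 by rewrite ltnS; exact: gapF.
  by exists (Ordinal xF); rewrite // mem_enum inE.
pose G' := (@rev_ord F.+1 @^-1: G)%SET.
have cardG' : #|G'| = #|G| by apply: card_preimset; exact: rev_ord_inj.
have GU : G :|: G' = [set: 'I_F.+1]%SET.
  apply/setP => i; rewrite !inE !gapE /= subSS -negb_and.
  apply/negP => /andP[/asboolP Hi /asboolP]; apply: HFN Hi.
  by rewrite -ltnS.
have /eqP/cards1P[x xI] : #|(G :&: G')%SET| = 1.
  have := cardsUI G G'; rewrite GU cardsT card_ord cardG' cardG; lia.
have GI (i : 'I_F.+1) : (i : nat) \in gaps H -> F - i \in gaps H -> i = x.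
  by move=> ig Fg; apply/set1P; rewrite -xI !inE /= subSS ig.
have /setIP[xG xG'] : x \in (G :&: G')%SET by rewrite xI inE.
have Fx : F = 2 * x.
  have /(congr1 val) /= : rev_ord x = x.
    apply: GI; first by move: xG'; rewrite !inE.
    by move: xG; rewrite inE /= subSS subKn// -ltnS.
  by have := ltn_ord x; lia.
exists x; rewrite -Fx; split=> [y|y yF yx].
  by rewrite ltnNge => /negP Fy; apply: contrapT => /(gap_le_frobenius nH).
split; first exact: HFN.
move=> HFy; apply: contrapT => Hy; apply: yx.
have yF' : y < F.+1 by [].
by rewrite -(GI (Ordinal yF')) //= gapE; apply/asboolPn.
Qed.

Lemma generated_shifted (a s t D x : nat) :
  generated [set a; a + s; a + t; a + D] x <->
  shifted a s t D x.
Proof.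
split.
  move=> /(_ [set y | shifted a s t D (Posz y)]); apply; split.
    split=> [|y z /= [k k0 [p [q [r [p0 q0 r0 pk yE]]]]]
                     [k' k'0 [p' [q' [r' [p'0 q'0 r'0 pk' zE]]]]]].
      by exists 0%R => //; exists 0%R, 0%R, 0%R; split=> //; lia.
    exists (k + k')%R; first lia.
    by exists (p + p')%R, (q + q')%R, (r + r')%R; split; lia.
  have b (y : nat) (p q r : int) : (0 <= p)%R -> (0 <= q)%R -> (0 <= r)%R ->
      (p + q + r <= 1)%R -> (Posz y = Posz a + (p * s + q * t + r * D))%R ->
      shifted a s t D y.
    by move=> *; exists 1%R => //; exists p, q, r; split=> //; lia.
  move=> y [[[|]|]|] /= ->.
  - by apply: (b _ 0 0 0)%R => //; lia.
  - by apply: (b _ 1 0 0)%R => //; lia.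
  - by apply: (b _ 0 1 0)%R => //; lia.
  - by apply: (b _ 0 0 1)%R => //; lia.
move=> [k k0 [p [q [r [p0 q0 r0 pk xE]]]]].
set S := [set a; _; _; _]; have M := submonoid_generated S.
have [_ HD] := M.
have Sa : generated S a by apply: sub_generated; left; left; left.
have Ss : generated S (a + s) by apply: sub_generated; left; left; right.
have St : generated S (a + t) by apply: sub_generated; left; right.
have SD : generated S (a + D) by apply: sub_generated; right.
(* [k'] counts the copies of the generator [a]. *)
have [k' kE] : exists k' : nat, (k = p + q + r + Posz k')%R.
  by exists (absz (k - (p + q + r))%R); lia.
have [p' pE] : exists p' : nat, p = Posz p' by exists (absz p); lia.
have [q' qE] : exists q' : nat, q = Posz q' by exists (absz q); lia.
have [r' rE] : exists r' : nat, r = Posz r' by exists (absz r); lia.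
have -> : x = k' * a + (p' * (a + s) + (q' * (a + t) + r' * (a + D))).
  by move: xE; rewrite kE pE qE rE; lia.
apply: (HD _ _ (submonoid_muln _ M Sa)).
apply: (HD _ _ (submonoid_muln _ M Ss)).
exact: HD _ _ (submonoid_muln _ M St) (submonoid_muln _ M SD).
Qed.


Theorem theorem7p6 (n1 n2 n3 n4 : nat) :
  n1 < n2 -> n2 < n3 -> n3 < n4 ->
  numerical_semigroup (generated [set n1; n2; n3; n4]) ->
  minimally_generates [set n1; n2; n3; n4] (generated [set n1; n2; n3; n4]) ->
  exists M : nat, forall m : nat, M <= m ->
    numerical_semigroup (generated [set n1 + m; n2 + m; n3 + m; n4 + m]) ->
    ~ (almost_symmetric (generated [set n1 + m; n2 + m; n3 + m; n4 + m]) /\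
       semigroup_type (generated [set n1 + m; n2 + m; n3 + m; n4 + m]) = 2).
Proof.
move=> n12 n23 n34 _ _; set s := n2 - n1; set t := n3 - n1; set D := n4 - n1.
have n2E m : n2 + m = n1 + m + s by lia.
have n3E m : n3 + m = n1 + m + t by lia.
have n4E m : n4 + m = n1 + m + D by lia.
exists (100 * D ^ 2) => m Mm; rewrite n2E n3E n4E; set a := n1 + m => nH [AS t2].
have [h [hbig hE]] := almost_symmetric_type2_reflection _ nH AS t2.
have D0 : 0 < D by lia.
have a0 : 0 < a by rewrite /a; nia.
have gcd1 := (numerical_semigroup_gcdP _ _ _ a0).1 nH.
apply: (shifted_not_pseudo_symmetric a s t D (gcdn (gcdn s t) D) h) => //.
- by lia.
- by lia.
- by lia.
- rewrite coprimezE /= /coprime -dvdn1 -gcd1 !dvdn_gcd dvdn_gcdl.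
  (* A common divisor of [a] and [gcd(s, t, D)] divides all four generators. *)
  set g := gcdn a _; have ga : g %| a by exact: dvdn_gcdl.
  have gd : g %| gcdn (gcdn s t) D by exact: dvdn_gcdr.
  have gD : g %| D := dvdn_trans gd (dvdn_gcdr _ _).
  have gs : g %| s := dvdn_trans gd (dvdn_trans (dvdn_gcdl _ _) (dvdn_gcdl _ _)).
  have gt : g %| t := dvdn_trans gd (dvdn_trans (dvdn_gcdl _ _) (dvdn_gcdr _ _)).
  by rewrite !(dvdn_add ga).
(* The reflection extends from [[0, 2 * h]] to all integers: negative ones are non-elements, those
   beyond [2 * h] elements. *)
have neg (x : int) : (x < 0)%R -> ~ shifted a s t D x.
  move=> x0 [k k0 l].
  have sD : (0 <= Posz s <= Posz D)%R by lia.
  have tD : (0 <= Posz t <= Posz D)%R by lia.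
  have /andP[? _] := level_bounds _ _ _ _ _ (D0 : (0 < Posz D)%R) sD tD l.
  have : (0 <= k * a)%R by nia.
  by lia.
have big (x : int) : (2 * Posz h < x)%R -> shifted a s t D x.
  case: x => [x xh|]; last by lia.
  have /hbig Hx : 2 * h < x by lia.
  exact: (generated_shifted _ _ _ _ _).1 Hx.
move=> x xh; have [x0|x0] : (x < 0 :> int)%R \/ (0 <= x :> int)%R by lia.
  by split=> [/(neg _ x0)//|[]]; apply: big; lia.
have [hx|xh2] : (2 * Posz h < x)%R \/ (x <= 2 * Posz h)%R by lia.
  by split=> [_|_]; [apply: neg; lia|exact: big].
case: x => [x|//] in xh x0 xh2 *.
rewrite (_ : (2 * _ - _)%R = Posz (2 * h - x)); last by lia.
by rewrite -!generated_shifted; apply: hE; [lia|move=> e; rewrite e eqxx in xh].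
Qed.
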